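(* Consider the case of two classes, $K=2$, with $A_1=1$, $A_2=C$, $\gamma_1=\gamma_2=1$, $\mu_1=\mu_2=0$. For every sufficiently large integer $C$, there exist $\lambda_1>0$ and $\lambda_2>0$ such that the corresponding energy function $\phi:(0,\infty)^2\to\mathbb{R}$, $$\phi(\rho)=-\log Z(\rho)+\sum_{k=1}^{2}(\rho_k-\lambda_k\log\rho_k),\qquad Z(\rho)=\rho_2+\sum_{n=0}^{C}\frac{\rho_1^n}{n!},$$ has at least one saddle point and two local minima.
   Context: In general, for a network with $K$ classes of customers, arrival rates $\lambda_k$, departure rates $\mu_k$, transfer rates $\gamma_k$, capacity requirements $A_k$ and node capacity $C$, the energy function is $$\phi(\rho)=-\log\left(\sum_{n\in\mathcal{X}}\prod_{k=1}^K\frac{\rho_k^{n_k}}{n_k!}\right)+\sum_{k=1}^K\left(\frac{\gamma_k+\mu_k}{\gamma_k}\rho_k-\frac{\lambda_k}{\gamma_k}\log\rho_k\right),\qquad \rho\in(0,\infty)^K,$$ with $\mathcal{X}=\{n\in\mathbb{N}^K:\sum_kA_kn_k\le C\}$, $\mathbb{N}=\{0,1,2,\dots\}$; the formula in the claim is its specialization to the stated parameters. A saddle point is a critical point which is neither a local minimum nor a local maximum. *)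

(* Defs.v *)
From mathcomp Require Export all_boot all_order all_algebra.
From mathcomp Require Export all_classical all_reals all_analysis.
Export numFieldNormedType.Exports.

Set Implicit Arguments.
Unset Strict Implicit.
Unset Printing Implicit Defensive.

Import Order.TTheory GRing.Theory Num.Theory.

Local Open Scope classical_set_scope.
Local Open Scope ring_scope.

Section Energy.
Variables (R : realType) (K : nat).

Definition orthant : set 'rV[R]_K := [set rho | forall k, 0 < rho 0 k].

Definition states (A : 'I_K -> nat) (C : nat) : set {ffun 'I_K -> nat} :=
  [set n | (\sum_k A k * n k <= C)%N].

(* The capacity requirements are meant to be positive: [states A C] is then
   finite.  Over an infinite support, the sum below would default to 0. *)
Definition partition_function (A : 'I_K -> nat) (C : nat) (rho : 'rV[R]_K) : R :=
  \sum_(n \in states A C) \prod_k (rho 0 k ^+ n k / (n k)`!%:R).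

(* Only meaningful on [orthant], since [ln] is 0 on nonpositive reals. *)
Definition energy (lambda mu gamma : 'I_K -> R) (A : 'I_K -> nat) (C : nat)
    (rho : 'rV[R]_K) : R :=
  - ln (partition_function A C rho) +
  \sum_k ((gamma k + mu k) / gamma k * rho 0 k
          - lambda k / gamma k * ln (rho 0 k)).

End Energy.

Section CriticalPoints.
Variables (R : realType) (V : normedModType R).
Implicit Types (D : set V) (f : V -> R) (x : V).

Definition local_minimum D f x :=
  D x /\ \forall y \near x, D y -> f x <= f y.

Definition local_maximum D f x :=
  D x /\ \forall y \near x, D y -> f y <= f x.

(* [D] is meant to be open. *)
Definition critical_point D f x :=
  [/\ D x, differentiable f x & 'd f x = (fun=> 0) :> (V -> R)].

Definition saddle_point D f x :=
  [/\ critical_point D f x, ~ local_minimum D f x & ~ local_maximum D f x].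

End CriticalPoints.

(* Index 0 of ['I_2] is the class with capacity requirement 1, index 1 the
   class with requirement [C]. *)
Definition energy2 (R : realType) (lambda1 lambda2 : R) (C : nat)
    (rho : 'rV[R]_2) : R :=
  energy (tnth [tuple lambda1; lambda2]) (fun=> 0) (fun=> 1)
    (tnth [tuple 1%N; C]) C rho.

Lemma partition_function2E (R : realType) (C : nat) (rho : 'rV[R]_2) :
  (0 < C)%N ->
  partition_function (tnth [tuple 1%N; C]) C rho =
  rho 0 1 + \sum_(0 <= n < C.+1) rho 0 0 ^+ n / n`!%:R.
Proof.
move=> C0; rewrite /partition_function.
pose s (a b : nat) : {ffun 'I_2 -> nat} := [ffun k => if k == 0 then a else b].
have sE (n : {ffun 'I_2 -> nat}) : n = s (n 0) (n 1).
  apply/ffunP => k; rewrite ffunE; case: ifPn => [/eqP -> //|k0].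
  by congr (n _); apply/val_inj; case: k k0 => [[|[|]]].
rewrite (fsbig_fwiden (s 0%N 1%N :: [seq s n 0%N | n <- iota 0 C.+1])).
- rewrite big_cons big_map /index_iota subn0; congr (_ + _).
    rewrite !big_ord_recl big_ord0 !ffunE /= expr0 fact0 factS fact0 expr1.
    by rewrite !mulr1 !divr1 mul1r; congr (rho _ _); apply/val_inj.
  apply: eq_bigr => i _.
  rewrite !big_ord_recl big_ord0 !ffunE /= expr0 fact0.
  by rewrite divr1 !mulr1.
- move=> n; rewrite /states /= (sE n) !big_ord_recl big_ord0 !ffunE /=.
  rewrite /tnth /= mul1n addn0 => nC.
  rewrite inE; case: (n 1) nC => [|[|m]] nC.
  + apply/orP; right; rewrite -[_ :: _]/([seq s i 0%N | i <- iota 0 C.+1]).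
    apply/mapP; exists (n 0) => //.
    by rewrite mem_iota add0n ltnS; move: nC; rewrite muln0 addn0.
  + rewrite muln1 in nC; have -> : n 0 = 0%N.
      by apply/eqP; rewrite -leqn0 -(leq_add2r C) add0n.
    by rewrite eqxx.
  + exfalso; move: nC; rewrite leqNgt => /negP; apply.
    rewrite (leq_trans _ (leq_addl _ _))//.
    by rewrite -[ltnLHS]muln1 ltn_mul2l C0.
- rewrite cons_uniq map_inj_uniq ?iota_uniq ?andbT.
    by apply/mapP => -[i _ /ffunP /(_ 1)]; rewrite !ffunE.
  by move=> i j /ffunP /(_ 0); rewrite !ffunE.
- move=> n []; rewrite mksetE inE => nr nX; case: nX; case/orP: nr.
  + move=> /eqP ->.
    by rewrite /states /= !big_ord_recl big_ord0 !ffunE /= /tnth /= muln0 muln1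
               addn0.
  + move=> /mapP[i + ->]; rewrite mem_iota add0n ltnS /= => iC.
    by rewrite /states /= !big_ord_recl big_ord0 !ffunE /= /tnth /= mul1n muln0
               !addn0.
Qed.

Lemma energy2E (R : realType) (lambda1 lambda2 : R) (C : nat) (rho : 'rV[R]_2) :
  (0 < C)%N ->
  energy2 lambda1 lambda2 C rho =
  - ln (rho 0 1 + \sum_(0 <= n < C.+1) rho 0 0 ^+ n / n`!%:R)
  + ((rho 0 0 - lambda1 * ln (rho 0 0)) + (rho 0 1 - lambda2 * ln (rho 0 1))).
Proof.
move=> C0; rewrite /energy2 /energy partition_function2E//.
rewrite !big_ord_recl big_ord0 /tnth /= !addr0 !divr1 !mul1r.
by rewrite (_ : lift ord0 ord0 = 1)//; apply/val_inj.
Qed.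

(* Main.v *)
From HB Require Import structures.
Require Import Defs.
From mathcomp Require Import ring lra.

(** The saddle is placed by hand. Write [E] for the truncated exponential of
degree [C], so that the energy is
[phi x y = - ln (y + E x) + (x - a * ln x) + (y - b * ln y)].
For any point [(x0, y0)] the two critical equations can be solved for positive
rates [a] and [b]. Along a vertical line only logarithms of affine functions of [y]
occur, so [phi] is strictly convex there and [y0] is the strict minimum on the
line [x = x0] ([phi_lt_vertical]). Along the horizontal line the second
derivative at [x0] is
[a / x0 ^+ 2 - E'' / (y0 + E) + (E' / (y0 + E)) ^+ 2].
When [C] is large compared with [x0], the values of [E], [E'] and [E''] at [x0]
nearly agree; with [y0 = E x0] the second derivative is then close to
[1 / (2 * x0) - 1 / 4], which is negative once [2 < x0]. The choice [x0 = 4]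
leaves enough room for [C >= 17] ([texp_ratio]). Hence [(x0, y0)] is a strict
minimum vertically and a strict maximum horizontally: a saddle point.

The minima then come from compactness. Put [h = phi x0 y0]. The line [x = x0]
is a wall on which [phi >= h], while the horizontal direction supplies points
with [phi < h] on both sides of it. As [E] is bounded by a power of [1 + x],
[phi] dominates a sum of two coercive functions of one variable, so its sublevel
sets in the quadrant lie in compact boxes ([phi_coercive]). On each side of the
wall the minimum of [phi] is therefore attained, below [h] and so away from the
wall ([basin_local_minimum]). No equation for the minima is ever solved. *)

Set Implicit Arguments.
Unset Strict Implicit.
Unset Printing Implicit Defensive.

Import Order.TTheory GRing.Theory Num.Theory.
Local Open Scope classical_set_scope.
Local Open Scope ring_scope.

(** * Local minima and maxima *)

(** The minimum over the compact set [closure U `&` K] is below [h], hence it is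
not on the wall; nearby points of [D] outside [K] have values above [h], so
they cannot undercut it. *)
Lemma basin_local_minimum (R : realType) (V : normedModType R) (f : V -> R)
    (D U K : set V) (h : R) (z : V) :
  open U -> compact K -> K `<=` D -> {in D, continuous f} ->
  (forall y, D y -> f y <= h -> K y) ->
  (forall y, D y -> closure U y -> ~ U y -> h <= f y) ->
  D z -> U z -> f z < h ->
  exists2 c, U c & local_minimum D f c.
Proof.
move=> oU cK KD fD subK wall Dz Uz fz.
have cA : compact (closure U `&` K).
  by rewrite setIC; apply: compact_closedI => //; exact: closed_closure.
have A0 : (closure U `&` K) !=set0.
  by exists z; split; [exact: subset_closure|exact: subK (ltW fz)].
have fA : {within closure U `&` K, continuous f}.
  apply: continuous_in_subspaceT => y; rewrite inE => -[_ /KD Dy].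
  by apply: fD; rewrite inE.
have [c] := compact_EVT_min A0 cA fA; rewrite inE => -[Uc Kc] cmin.
have {}cmin y : closure U y -> K y -> f c <= f y.
  by move=> Uy Ky; apply: cmin; rewrite inE.
have fch : f c < h.
  apply: (le_lt_trans _ fz).
  by apply: cmin; [exact: subset_closure|exact: subK (ltW fz)].
have {}Uc : U c.
  by apply: contrapT => nUc; have := wall _ (KD _ Kc) Uc nUc; rewrite leNgt fch.
exists c => //; split; first exact: KD.
have : nbhs c U by exact: open_nbhs_nbhs.
apply: filterS => y Uy Dy.
have [fy|/ltW fy] := leP (f y) h.
  by apply: cmin; [exact: subset_closure|exact: subK].
exact: le_trans (ltW fch) fy.
Qed.

(** Since [df c = 0] and [df] has a negative slope at [c], the sign of [df x]
is opposite to that of [x - c] near [c]; the mean value theorem turns this into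
a strict decrease on both sides. *)
Lemma strict_local_max (R : realType) (f df : R -> R) (c d : R) :
  (\forall x \near c, is_derive (x : R) (1 : R) f (df x)) -> df c = 0 ->
  is_derive c (1 : R) df d -> d < 0 ->
  \forall x \near c^', f x < f c.
Proof.
move=> fdf dfc [ddf <-] d0.
have /cvgrPdist_lt/(_ (- 'D_1 df c)) :
    h^-1 *: ((df \o shift c) (h *: 1) - df c) @[h --> 0^'] --> 'D_1 df c.
  exact: ddf.
rewrite oppr_gt0 => /(_ d0) [e /= e0 eP].
have {fdf} [e' /= e'0 e'P] := fdf.
pose r := Num.min e e'.
have dfs x : x != c -> `|x - c| < e -> df x * (x - c) < 0.
  move=> xc xe.
  have := eP (x - c); rewrite /= sub0r normrN subr_eq0 => /(_ xe xc).
  rewrite dfc subr0 /shift /= [_%:A]mulr1 subrK.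
  have xc0 : 0 < (x - c) ^+ 2 by rewrite exprn_even_gt0// subr_eq0.
  (* the difference quotient at [x], times a square *)
  have -> : df x * (x - c) = ((x - c)^-1 *: df x) * (x - c) ^+ 2.
    by rewrite -[_ *: _]/(_ * _); field; rewrite subr_eq0.
  move=> quot; rewrite pmulr_llt0//.
  have := ler_norm (- ('D_1 df c - (x - c)^-1 *: df x)); rewrite normrN; lra.
have fd x : `|x - c| < e' -> is_derive x (1 : R) f (df x).
  by rewrite distrC; exact: e'P.
exists r => /=; first by rewrite /r lt_min e0.
move=> x /=; rewrite distrC lt_min => /andP[xe xe'] xc.
have contf u v : (forall t, t \in `[u, v] -> `|t - c| < e') ->
    {within `[u, v], continuous f}.
  move=> uv; apply: derivable_within_continuous => t /uv /fd tuv.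
  exact: ex_derive.
case: (ltgtP x c) xc => // xc _.
- have B t : t \in `[x, c] -> `|t - c| <= `|x - c|.
    rewrite in_itv/= => /andP[xt tc].
    by rewrite !ler0_norm ?subr_le0 ?(ltW xc)// lerN2 lerD2r.
  have [//||t tI] := @MVT _ f df _ _ xc.
  + by move=> t /subset_itv_oo_cc/B tB; apply: fd; exact: le_lt_trans xe'.
  + by apply: contf => t /B tB; exact: le_lt_trans xe'.
  + have tB := B _ (subset_itv_oo_cc tI).
    move: tI; rewrite in_itv/= => /andP[xt tc] fE.
    have := dfs t (negbT (lt_eqF tc)) (le_lt_trans tB xe).
    rewrite nmulr_llt0 ?subr_lt0// => dft.
    by rewrite -subr_gt0 fE mulr_gt0// subr_gt0.
- have B t : t \in `[c, x] -> `|t - c| <= `|x - c|.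
    rewrite in_itv/= => /andP[ct tx].
    by rewrite !ger0_norm ?subr_ge0 ?(ltW xc)// lerD2r.
  have [//||t tI] := @MVT _ f df _ _ xc.
  + by move=> t /subset_itv_oo_cc/B tB; apply: fd; exact: le_lt_trans xe'.
  + by apply: contf => t /B tB; exact: le_lt_trans xe'.
  + have tB := B _ (subset_itv_oo_cc tI).
    move: tI; rewrite in_itv/= => /andP[ct tx] fE.
    have := dfs t (negbT (gt_eqF ct)) (le_lt_trans tB xe).
    rewrite pmulr_llt0 ?subr_gt0// => dft.
    by rewrite -subr_lt0 fE pmulr_llt0// subr_gt0.
Qed.

(** * Coercive functions of one variable *)

Section one_variable.
Variable R : realType.
Implicit Types (m c u t : R).

Lemma ln_le_subr1 t : 0 < t -> ln t <= t - 1.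
Proof.
move=> t0; have := @le_ln1Dx R (t - 1).
by rewrite addrCA subrr addr0; apply; lra.
Qed.

Lemma ln_lt_subr1 t : 0 < t -> t != 1 -> ln t < t - 1.
Proof.
move=> t0 t1; rewrite -ltr_expR lnK//.
have := @expR_gt1Dx R (t - 1); rewrite addrCA subrr addr0; apply.
by rewrite subr_eq0.
Qed.

Lemma ln_le_tangent t u : 0 < t -> 0 < u -> ln t <= ln u + (t - u) / u.
Proof.
move=> t0 u0; have := ln_le_subr1 (divr_gt0 t0 u0).
by rewrite ln_div// mulrBl divff ?lt0r_neq0//; lra.
Qed.

Lemma ln_lt_tangent t u :
  0 < t -> 0 < u -> t != u -> ln t < ln u + (t - u) / u.
Proof.
move=> t0 u0 tu; have := ln_lt_subr1 (divr_gt0 t0 u0).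
rewrite ln_div// mulrBl divff ?lt0r_neq0// => tu1.
suff /tu1 : t / u != 1 by lra.
by apply: contra tu => /eqP tu1'; rewrite -(divfK (lt0r_neq0 u0) t) tu1' mul1r.
Qed.

(** With [m] the degree of growth of the partition function in the variable [u]
and [c] the arrival rate, this is the contribution of [u] to a lower bound of
the energy. *)
Definition barrier m c u : R := u - m * ln (1 + u) - c * ln u.

(** Tangent lines of [ln] of small slope show that [barrier] grows linearly. *)
Lemma barrier_ge m c : 0 <= m -> 0 < c ->
  exists K, forall u, 0 < u -> u / 2 - K <= barrier m c u.
Proof.
(* at the abscissa [k] the tangents of the two logarithms use up half of [u] *)
move=> m0 c0; pose k := 2 * (m + c).
have k0 : 0 < k by rewrite /k; lra.
exists ((m + c) * ln k + 1 / 2) => u u0; rewrite /barrier.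
have mk : m * (1 + u) / k + c * u / k <= u / 2 + 1 / 2.
  rewrite -mulrDl ler_pdivrMr// /k; nra.
have h1 : ln (1 + u) <= ln k + (1 + u - k) / k.
  by apply: ln_le_tangent => //; lra.
have h2 : ln u <= ln k + (u - k) / k by apply: ln_le_tangent.
have e1 : (1 + u - k) / k = (1 + u) / k - 1 by field; lra.
have e2 : (u - k) / k = u / k - 1 by field; lra.
rewrite e1 in h1; rewrite e2 in h2.
have := ler_wpM2l m0 h1; have := ler_wpM2l (ltW c0) h2.
rewrite -/k !mulrDr !mulrDl !(mulrA _ _ k^-1); lra.
Qed.

(** Linear growth bounds [u] from above; then [- c * ln u] is the only term that
is not bounded near [0], and it bounds [u] from below. *)
Lemma barrier_coercive m c B : 0 <= m -> 0 < c ->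
  exists l r, 0 < l /\ forall u, 0 < u -> barrier m c u <= B -> l <= u <= r.
Proof.
move=> m0 c0; have [K HK] := barrier_ge m0 c0.
pose r := 2 * (B + K).
exists (expR (- (B + m * r) / c)), r; split; first exact: expR_gt0.
move=> u u0 uB; have ur : u <= r by have := HK u u0; rewrite /r; lra.
rewrite ur andbT -[leRHS](lnK u0) ler_expR ler_pdivrMr//.
have := @le_ln1Dx R u; rewrite /barrier in uB.
have /[swap]/[apply] : -1 < u by lra.
move/(ler_wpM2l m0); nra.
Qed.

End one_variable.

(** * The truncated exponential *)

Section truncated_exponential.
Variable R : realType.
Implicit Types (n : nat) (x : R).

Definition texp n : {poly R} := \poly_(i < n.+1) (i`!%:R)^-1.

Lemma horner_texp n x :
  (texp n).[x] = \sum_(0 <= i < n.+1) x ^+ i / i`!%:R.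
Proof.
rewrite /texp horner_poly big_mkord; apply: eq_bigr => i _; exact: mulrC.
Qed.

Lemma deriv_texp n : (texp n.+1)^`() = texp n.
Proof.
apply/polyP => i; rewrite coef_deriv !coef_poly ltnS.
case: ifP => _; last by rewrite mul0rn.
by rewrite factS natrM invfM -[LHS]mulr_natr mulrAC mulVf ?mul1r.
Qed.

Lemma texpS n x :
  (texp n.+1).[x] = (texp n).[x] + x ^+ n.+1 / n.+1`!%:R.
Proof. by rewrite !horner_texp big_nat_recr. Qed.

Lemma texp0 x : (texp 0).[x] = 1.
Proof. by rewrite horner_texp big_nat1 expr0 fact0 divr1. Qed.

Lemma texp_monomial_ge0 n x : 0 <= x -> 0 <= x ^+ n / n`!%:R.
Proof. by move=> x0; rewrite divr_ge0// exprn_ge0. Qed.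

Lemma texp_leS n x : 0 <= x -> (texp n).[x] <= (texp n.+1).[x].
Proof. by move=> x0; rewrite texpS lerDl texp_monomial_ge0. Qed.

Lemma texp_ge1 n x : 0 <= x -> 1 <= (texp n).[x].
Proof.
move=> x0; elim: n => [|n IH]; first by rewrite texp0.
exact: le_trans (texp_leS _ x0).
Qed.

Lemma monomial_le_texp n x : 0 <= x -> x ^+ n / n`!%:R <= (texp n).[x].
Proof.
move=> x0; case: n => [|n]; first by rewrite texp0 expr0 divr1.
by rewrite texpS lerDr (le_trans ler01)// texp_ge1.
Qed.

(** A polynomial bound is essential: the linear term of the energy does not
dominate [ln (expR x)]. *)
Lemma texp_le n x : 0 <= x -> (texp n).[x] <= (1 + x) ^+ n.
Proof.
move=> x0; elim: n => [|n IH]; first by rewrite texp0 expr0.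
rewrite texpS [leRHS]exprS mulrDl mul1r lerD//.
apply: (@le_trans _ _ (x ^+ n.+1)).
  by rewrite ler_piMr ?exprn_ge0// invf_le1 ?ler1n ?ltr0n ?fact_gt0.
rewrite exprS ler_wpM2l// lerXn2r ?nnegrE//; lra.
Qed.

(** From the index 15 on each monomial at 4 is at most a quarter of the previous
one, so the last two add at most the fraction [1 / 4 + 1 / 16 < 1 / 3] of the
others. *)
Lemma texp_ratio n : (15 <= n)%N ->
  3 * (texp n.+2).[4] < 4 * (texp n).[4] :> R.
Proof.
move=> n15.
have step k : (15 <= k)%N ->
    4 ^+ k.+1 / k.+1`!%:R <= 4 ^+ k / k`!%:R / 4 :> R.
  move=> k15; rewrite factS natrM exprS invfM mulrACA mulrC ler_wpM2l//.
  rewrite ler_pdivrMr ?ltr0n// ler_pdivlMl//.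
  have : 16 <= k.+1%:R :> R by rewrite ler_nat.
  lra.
have s1 := step _ n15; have s2 := step _ (leqW n15).
have u := @monomial_le_texp n 4 (ler0n _ _).
have e := @texp_ge1 n 4 (ler0n _ _).
rewrite !texpS; lra.
Qed.

End truncated_exponential.

(** * The energy as a function of two variables *)

Section reduced_energy.
Variables (R : realType) (p : {poly R}).
Implicit Types (a b x y : R).
Hypothesis p_gt0 : forall x, 0 < x -> 0 < p.[x].

Definition phi a b x y := - ln (y + p.[x]) + (x - a * ln x + (y - b * ln y)).

Let Z_gt0 x y : 0 < x -> 0 < y -> 0 < y + p.[x].
Proof. by move=> x0 y0; rewrite addr_gt0// p_gt0. Qed.

(** Strict convexity in [y]: bounding both logarithms by their tangents at [y0]
leaves a linear function of [y - y0], whose slope vanishes by criticality. *)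
Lemma phi_lt_vertical a b x y0 y : 0 <= b -> 0 < x -> 0 < y0 -> 0 < y ->
  1 - b / y0 - (y0 + p.[x])^-1 = 0 -> y != y0 -> phi a b x y0 < phi a b x y.
Proof.
move=> b0 x0 y00 yp crit yy0; rewrite /phi.
have Zy0 := Z_gt0 x0 y00.
have /(ln_lt_tangent (Z_gt0 x0 yp) Zy0) h1 : y + p.[x] != y0 + p.[x].
  by rewrite (inj_eq (addIr _)).
have h2 := ler_wpM2l b0 (ln_le_tangent yp y00).
have e : (y + p.[x] - (y0 + p.[x])) / (y0 + p.[x]) + b * ((y - y0) / y0)
      = y - y0.
  have -> : y + p.[x] - (y0 + p.[x]) = y - y0 by ring.
  (* the critical equation, solved for the inverse of the partition function *)
  have -> : (y0 + p.[x])^-1 = 1 - b / y0 by lra.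
  by field; rewrite lt0r_neq0.
rewrite mulrDr in h2; lra.
Qed.

(** The bound [y + p.[x] <= (1 + y) * (1 + x) ^+ m] separates the variables, so
[phi] dominates a sum of two barriers; each of them is bounded below, hence
each is bounded above on a sublevel set. *)
Lemma phi_coercive a b (m : nat) h : 0 < a -> 0 < b ->
  (forall x, 0 < x -> p.[x] <= (1 + x) ^+ m) ->
  exists l r, 0 < l /\ forall x y, 0 < x -> 0 < y -> phi a b x y <= h ->
    (l <= x <= r) && (l <= y <= r).
Proof.
move=> a0 b0 pm.
have m0 : 0 <= m%:R :> R by [].
have lower x y : 0 < x -> 0 < y ->
    barrier m%:R a x + barrier 1 b y <= phi a b x y.
  move=> x0 y0; rewrite /barrier /phi.
  have x1 : 1 <= (1 + x) ^+ m by rewrite exprn_ege1//; lra.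
  suff : ln (y + p.[x]) <= ln (1 + y) + m%:R * ln (1 + x) by lra.
  rewrite mulr_natl -lnXn; last by lra.
  rewrite -lnM ?posrE; [|lra|lra].
  rewrite ler_ln ?posrE ?Z_gt0// ?mulr_gt0//; [|lra|lra].
  have := pm _ x0; nra.
have [K1 HK1] := barrier_ge m0 a0.
have [K2 HK2] := barrier_ge (@ler01 R) b0.
have [l1 [r1 [l10 H1]]] := barrier_coercive (h + K2) m0 a0.
have [l2 [r2 [l20 H2]]] := barrier_coercive (h + K1) (@ler01 R) b0.
exists (Num.min l1 l2), (Num.max r1 r2); split; first by rewrite lt_min l10.
move=> x y x0 y0 /(le_trans (lower _ _ x0 y0)) xyh.
have := HK1 _ x0; have := HK2 _ y0 => b2 b1.
have /andP[lx xr] : l1 <= x <= r1 by apply: H1 => //; lra.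
have /andP[ly yr] : l2 <= y <= r2 by apply: H2 => //; lra.
by rewrite !ge_min !le_max lx xr ly yr !orbT.
Qed.

(** The partial derivative of [phi] with respect to [x]. *)
Definition phix a x y := 1 - a / x - p^`().[x] / (y + p.[x]).

Lemma is_derive_phi_horizontal a b x y : 0 < x -> 0 < y ->
  is_derive x (1 : R) (phi a b ^~ y) (phix a x y).
Proof.
move=> x0 y0; have Z0 := Z_gt0 x0 y0.
have dln := is_derive1_ln x0; have dlnZ := is_derive1_ln Z0.
have dZ : is_derive x (1 : R) (fun x => y + p.[x]) p^`().[x].
  by apply: is_derive_eq; rewrite add0r mul1r.
have dlZ : is_derive x (1 : R) (fun x => ln (y + p.[x]))
    ((y + p.[x])^-1 * p^`().[x]).
  exact: (@is_derive1_comp _ (@ln R) (fun x => y + p.[x])).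
apply: is_derive_eq; rewrite /phix.
by rewrite -?[_ *: _]/(_ * _); field; rewrite !lt0r_neq0.
Qed.

Lemma is_derive_phix a x y : 0 < x -> 0 < y ->
  is_derive x (1 : R) (phix a ^~ y)
   (a / x ^+ 2 - (p^`()^`().[x] * (y + p.[x]) - p^`().[x] ^+ 2)
                 / (y + p.[x]) ^+ 2).
Proof.
move=> x0 y0; have Z0 := Z_gt0 x0 y0.
have dZ : is_derive x (1 : R) (fun x => y + p.[x]) p^`().[x].
  by apply: is_derive_eq; rewrite add0r mul1r.
have dV : is_derive x (1 : R) (fun x : R => x^-1) (- (x ^- 2) *: 1).
  by apply: (@is_deriveV _ id); rewrite lt0r_neq0.
have dVZ : is_derive x (1 : R) (fun x => (y + p.[x])^-1)
   (- (y + p.[x]) ^- 2 *: p^`().[x]).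
  by apply: (@is_deriveV _ (fun x => y + p.[x])); rewrite lt0r_neq0.
rewrite /phix.
apply: is_derive_eq.
by rewrite -?[_ *: _]/(_ * _); field; rewrite !lt0r_neq0.
Qed.

Lemma is_diff_coord m n (M : 'M[R]_(m, n)) i j :
  is_diff M (fun N : 'M[R]_(m, n) => N i j) (fun N : 'M[R]_(m, n) => N i j).
Proof.
pose coord (N : 'M[R]_(m, n)) := N i j.
have coord_linear : linear coord by move=> k u v; rewrite /coord !mxE.
pose coordL : {linear 'M[R]_(m, n) -> R} :=
  HB.pack coord (GRing.isLinear.Build _ _ _ _ _ coord_linear).
apply: DiffDef; first exact: differentiable_coord.
have coordE : 'd coordL M = coordL :> (_ -> _).
  by apply: diff_lin; exact: coord_continuous.
exact: coordE.
Qed.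

Lemma is_diff_comp1 (V : normedModType R) (u du : V -> R) (g : R -> R)
    (c : R) v :
  is_diff v u du -> is_derive (u v) (1 : R) g c ->
  is_diff v (g \o u) (fun w => c * du w).
Proof.
move=> uv [/[dup] dg /derivable1_diffP gc gE].
have dg' : is_diff (u v) g (fun h => h *: c).
  by apply: DiffDef => //; rewrite deriv1E// derive1E gE.
apply: is_diff_eq; apply/funext => w /=; exact: mulrC.
Qed.

Lemma is_diff_phi a b (rho : 'rV[R]_2) : 0 < rho 0 0 -> 0 < rho 0 1 ->
  is_diff rho (fun v : 'rV[R]_2 => phi a b (v 0 0) (v 0 1))
    (fun v : 'rV[R]_2 => phix a (rho 0 0) (rho 0 1) * v 0 0 +
      (1 - b / rho 0 1 - (rho 0 1 + p.[rho 0 0])^-1) * v 0 1).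
Proof.
move=> x0 y0; have Z0 := Z_gt0 x0 y0.
have d0 := is_diff_coord rho 0 0; have d1 := is_diff_coord rho 0 1.
have dp := is_diff_comp1 d0 (is_derive_poly p (rho 0 0)).
have dx := is_diff_comp1 d0 (is_derive1_ln x0).
have dy := is_diff_comp1 d1 (is_derive1_ln y0).
have dZ : is_diff rho (fun v : 'rV[R]_2 => v 0 1 + p.[v 0 0]) _ :=
  is_diffD d1 dp.
have dlZ := is_diff_comp1 dZ (is_derive1_ln Z0).
have H := is_diffD (is_diffN dlZ)
  (is_diffD (is_diffB d0 (is_diffZ a dx)) (is_diffB d1 (is_diffZ b dy))).
rewrite /phi; apply: (@is_diff_eq _ _ _ _ _ _ _ H).
apply/funext => v.
rewrite !fctE /phix -?[_ *: _]/(_ * _) /=.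
by rewrite -?[_ *: _]/(_ * _); field; rewrite !lt0r_neq0.
Qed.

End reduced_energy.

(** * The saddle and the two basins *)

Section saddle_and_minima.
Variable R : realType.

Definition point2 (x y : R) : 'rV[R]_2 := \row_k (if k == 0 then x else y).

Lemma point2_0 x y : point2 x y 0 0 = x. Proof. by rewrite mxE. Qed.
Lemma point2_1 x y : point2 x y 0 1 = y. Proof. by rewrite mxE. Qed.

Lemma ord2P (i : 'I_2) : i = 0 \/ i = 1.
Proof. by case: i => [[|[|]]]// i; [left|right]; apply/val_inj. Qed.

Lemma nbhs_point2 x y (P : set 'rV[R]_2) : nbhs (point2 x y) P ->
  exists2 e : R, 0 < e & forall x' y', `|x - x'| < e -> `|y - y'| < e ->
    P (point2 x' y').
Proof.
move=> /nbhs_ballP[e /= e0 eP]; exists e => // x' y' xx' yy'.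
by apply: eP; split=> // i j; rewrite !mxE; case: ifP.
Qed.

Lemma orthant_point2 x y : 0 < x -> 0 < y -> orthant (point2 x y).
Proof. by move=> x0 y0 k; rewrite mxE; case: ifP. Qed.

Lemma orthant2P (v : 'rV[R]_2) : orthant v <-> 0 < v 0 0 /\ 0 < v 0 1.
Proof.
split=> [v0|[v0 v1] k]; first by split; exact: v0.
by have [->|->] := ord2P k.
Qed.

(** A critical point of [phi] at which the second [x]-derivative is negative
separates two basins: it is the lowest point of the vertical line through it,
and the energy is lower on both sides of that line. The bound by a power of
[1 + x] makes the basins compact. *)
Lemma saddle_and_minima (p : {poly R}) (m : nat) (a b x0 y0 : R)
    (f := fun v : 'rV[R]_2 => phi p a b (v 0 0) (v 0 1)) :
  (forall x, 0 < x -> 0 < p.[x]) ->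
  (forall x, 0 < x -> p.[x] <= (1 + x) ^+ m) ->
  0 < a -> 0 < b -> 0 < x0 -> 0 < y0 ->
  phix p a x0 y0 = 0 ->
  1 - b / y0 - (y0 + p.[x0])^-1 = 0 ->
  a / x0 ^+ 2 - (p^`()^`().[x0] * (y0 + p.[x0]) - p^`().[x0] ^+ 2)
                / (y0 + p.[x0]) ^+ 2 < 0 ->
  saddle_point (@orthant R 2) f (point2 x0 y0) /\
  exists rho1 rho2 : 'rV[R]_2, [/\ rho1 <> rho2,
     local_minimum (@orthant R 2) f rho1 & local_minimum (@orthant R 2) f rho2].
Proof.
move=> p_gt0 pm a0 b0 x00 y00 critx crity phixx.
have fpt x y : f (point2 x y) = phi p a b x y by rewrite /f point2_0 point2_1.
pose h := f (point2 x0 y0).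
have vertical y : 0 < y -> y != y0 -> h < f (point2 x0 y).
  move=> y_gt0 yy0; rewrite /h !fpt.
  by apply: phi_lt_vertical => //; exact: ltW.
have [e e0 horizontal] : exists2 e : R, 0 < e &
    forall x, `|x0 - x| < e -> x != x0 -> f (point2 x y0) < h.
  have : \forall x \near x0^', phi p a b x y0 < phi p a b x0 y0.
    apply: (@strict_local_max _ (phi p a b ^~ y0) (phix p a ^~ y0)) phixx => //.
      near=> x; apply: is_derive_phi_horizontal => //.
      by near: x; exact: lt_nbhsr.
    exact: is_derive_phix.
  move=> [e /= e0 eP]; exists e => // x xe xx0.
  by rewrite /h !fpt; exact: eP.
have fD : {in @orthant R 2, continuous f}.
  move=> v; rewrite inE => /orthant2P[v0 v1]; apply: differentiable_continuous.
  by have [] := is_diff_phi p_gt0 a b v0 v1.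
split; last first.
  have [l [r [l0 box]]] := phi_coercive p_gt0 h a0 b0 pm.
  pose K : set 'rV[R]_2 := [set v | forall i, `[l, r]%classic (v ord0 i)].
  have cK : compact K.
    by apply: (@rV_compact _ _ (fun=> `[l, r]%classic)) => _;
      exact: segment_compact.
  have KD : K `<=` @orthant R 2.
    move=> v Kv k; have := Kv k; rewrite /= in_itv/=.
    by move=> /andP[/(lt_le_trans l0)].
  have subK y : orthant y -> f y <= h -> K y.
    move=> /orthant2P[v0 v1] /(box _ _ v0 v1) /andP[bx by_] i /=.
    rewrite in_itv/=.
    by have [->|->] := ord2P i.
  have wall v : orthant v -> v 0 0 = x0 -> h <= f v.
    move=> /orthant2P[v0 v1] vx.
    have [vy|vy] := eqVneq (v 0 1) y0; first by rewrite /h fpt /f vx vy.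
    by have := vertical _ v1 vy; rewrite fpt /f vx => /ltW.
  (* small enough to see the horizontal descent and to stay in the quadrant *)
  pose dx := Num.min (e / 2) (x0 / 2).
  have dx0 : 0 < dx by rewrite lt_min !divr_gt0.
  have dxe : dx < e by rewrite gt_min; apply/orP; left; lra.
  have dxx : dx < x0 by rewrite gt_min; apply/orP; right; lra.
  pose L : set 'rV[R]_2 := [set v | v 0 0 < x0].
  pose G : set 'rV[R]_2 := [set v | x0 < v 0 0].
  have oL : open L.
    by apply: (@open_comp _ _ (fun v : 'rV[R]_2 => v 0 0) [set t | t < x0]);
      [move=> v _; exact: coord_continuous|exact: open_lt].
  have oG : open G.
    by apply: (@open_comp _ _ (fun v : 'rV[R]_2 => v 0 0) [set t | x0 < t]);
      [move=> v _; exact: coord_continuous|exact: open_gt].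
  have clL : closure L `<=` [set v | v 0 0 <= x0].
    rewrite [X in _ `<=` X](proj1 (closure_id _) _).
      by apply: closureS => w /ltW.
    by apply: (@closed_comp _ _ (fun v : 'rV[R]_2 => v 0 0) [set t | t <= x0]);
      [move=> w _; exact: coord_continuous|exact: closed_le].
  have clG : closure G `<=` [set v | x0 <= v 0 0].
    rewrite [X in _ `<=` X](proj1 (closure_id _) _).
      by apply: closureS => w /ltW.
    by apply: (@closed_comp _ _ (fun v : 'rV[R]_2 => v 0 0) [set t | x0 <= t]);
      [move=> w _; exact: coord_continuous|exact: closed_ge].
  have [rho1 L1 min1] : exists2 c, L c & local_minimum (@orthant R 2) f c.
    apply: (@basin_local_minimum _ _ f _ L K h (point2 (x0 - dx) y0)) => //.
    - move=> v Dv /clL /= vx /negP; rewrite -leNgt => xv.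
      by apply: wall => //; apply/eqP; rewrite eq_le vx.
    - by apply: orthant_point2 => //; rewrite subr_gt0.
    - by rewrite /L /= point2_0; lra.
    - apply: horizontal; last by rewrite lt_eqF//; lra.
      by rewrite opprB addrCA subrr addr0 gtr0_norm.
  have [rho2 G2 min2] : exists2 c, G c & local_minimum (@orthant R 2) f c.
    apply: (@basin_local_minimum _ _ f _ G K h (point2 (x0 + dx) y0)) => //.
    - move=> v Dv /clG /= vx /negP; rewrite -leNgt => xv.
      by apply: wall => //; apply/eqP; rewrite eq_le vx andbT.
    - by apply: orthant_point2 => //; rewrite addr_gt0.
    - by rewrite /G /= point2_0; lra.
    - apply: horizontal; last by rewrite gt_eqF//; lra.
      by rewrite opprD addrA subrr add0r normrN gtr0_norm.
  exists rho1, rho2; split => // E.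
  by move: L1 G2; rewrite E /L /G /= => /ltW; rewrite leNgt => /negP.
have D0 := orthant_point2 x00 y00.
split.
- have px : 0 < point2 x0 y0 0 0 by rewrite point2_0.
  have py : 0 < point2 x0 y0 0 1 by rewrite point2_1.
  have df := is_diff_phi p_gt0 a b px py.
  split; [exact: D0|by case: df|].
  rewrite diff_val; apply/funext => v.
  by rewrite point2_0 point2_1 critx crity !mul0r addr0.
- move=> [_ /nbhs_point2[d d0 dP]].
  pose t := Num.min (d / 2) (e / 2).
  have t0 : 0 < t by rewrite lt_min !divr_gt0.
  have td : t < d by rewrite gt_min; apply/orP; left; lra.
  have te : t < e by rewrite gt_min; apply/orP; right; lra.
  have xt : `|x0 - (x0 + t)| = t.
    by rewrite opprD addrA subrr add0r normrN gtr0_norm.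
  have : f (point2 x0 y0) <= f (point2 (x0 + t) y0).
    apply: dP; rewrite ?xt// ?subrr ?normr0//.
    by apply: orthant_point2 => //; rewrite addr_gt0.
  by rewrite leNgt horizontal ?xt// gt_eqF//; lra.
- move=> [_ /nbhs_point2[d d0 dP]].
  have yt : `|y0 - (y0 + d / 2)| < d.
    by rewrite opprD addrA subrr add0r normrN gtr0_norm; lra.
  have : f (point2 x0 (y0 + d / 2)) <= f (point2 x0 y0).
    apply: dP; rewrite ?subrr ?normr0//.
    by apply: orthant_point2 => //; lra.
  by rewrite leNgt vertical//; [lra|rewrite gt_eqF//; lra].
Unshelve. all: by end_near. Qed.

End saddle_and_minima.

Theorem proposition7 (R : realType) :
  exists C0 : nat, forall C : nat, (C0 <= C)%N ->
  exists lambda1 lambda2 : R,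
    [/\ 0 < lambda1, 0 < lambda2,
        exists rho : 'rV[R]_2,
          saddle_point (@orthant R 2) (energy2 lambda1 lambda2 C) rho
      & exists rho1 rho2 : 'rV[R]_2,
          [/\ rho1 <> rho2,
              local_minimum (@orthant R 2) (energy2 lambda1 lambda2 C) rho1
            & local_minimum (@orthant R 2) (energy2 lambda1 lambda2 C) rho2]].
Proof.
exists 17%N => -[|[|n]]// n15.
have {}n15 : (15 <= n)%N by [].
pose p : {poly R} := texp R n.+2.
pose E : R := p.[4]; pose F : R := p^`().[4]; pose G : R := p^`()^`().[4].
have FE : F = (texp R n.+1).[4] by rewrite /F /p deriv_texp.
have GE : G = (texp R n).[4] by rewrite /G /p !deriv_texp.
have G1 : 1 <= G by rewrite GE texp_ge1.
have GF : G <= F by rewrite FE GE texp_leS.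
have FleE : F <= E by rewrite FE texp_leS.
have EG : 3 * E < 4 * G by rewrite GE; exact: texp_ratio.
(* the rates that make the point [(4, E)] critical *)
pose a : R := 4 * (1 - F / (E + E)).
pose b : R := E - 1 / 2.
have a0 : 0 < a.
  by rewrite /a pmulr_rgt0// subr_gt0 ltr_pdivrMr ?mul1r; lra.
have b0 : 0 < b by rewrite /b; lra.
have energyE : energy2 a b n.+2 =
    fun v : 'rV[R]_2 => phi p a b (v 0 0) (v 0 1).
  by apply/funext => v; rewrite energy2E// /phi horner_texp.
exists a, b; rewrite energyE.
have p0 x : 0 < x -> 0 < p.[x].
  by move=> /ltW x0; rewrite (lt_le_trans ltr01)// texp_ge1.
have pm x : 0 < x -> p.[x] <= (1 + x) ^+ n.+2.
  by move=> /ltW; exact: texp_le.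
have [] := @saddle_and_minima R p n.+2 a b 4 E p0 pm a0 b0.
- by [].
- lra.
- by rewrite /phix -/E -/F /a; field; lra.
- by rewrite -/E /b; field; lra.
- rewrite -/E -/F -/G /a.
  (* As [y0] is [E], the partition function is [2 * E] at the saddle. By
     [3 * E < 4 * G] the numerator is at most
     [F ^+ 2 - F * E / 2 - E ^+ 2 / 2 = (F - E) * (F + E / 2)]. *)
  rewrite [X in X < 0](_ : _ =
      (E ^+ 2 - F * E / 2 - 2 * G * E + F ^+ 2) / (2 * E) ^+ 2); last first.
    field; lra.
  rewrite pmulr_llt0; last by rewrite invr_gt0 exprn_gt0//; lra.
  nra.
by move=> saddle minima; split => //; exists (point2 4 E).
Qed.
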